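(* For every even $n\ge 6$, no preparation-noncontextual ontological model can win the $\mathrm{PoHM}_n$ task with certainty. That is, there is no operational theory admitting a preparation-noncontextual ontological model and containing a protocol for $\mathrm{HM}_n$ that is parity-oblivious and such that, for every $x\in\{0,1\}^n$ and every perfect matching $\mathtt M$ of $[n]$, every incorrect output $(\{i,j\},b)$ (with $\{i,j\}\in\mathtt M$ and $b\ne x_i\oplus x_j$) has probability $p((\{i,j\},b)\mid P_x,\mathtt M)=0$.
   Context: Operational theory: a set of preparations and a set of measurements with, for each preparation $P$ and measurement $M$, a probability distribution $p(k\mid P,M)$ over the outcomes $k$ of $M$. Probabilistic mixtures of preparations (sample $\alpha$ with probability $w_\alpha$, then implement $P_\alpha$) are again preparations, with statistics $\sum_\alpha w_\alpha\,p(k\mid P_\alpha,M)$. Ontological model: a measurable space $\Lambda$; for each preparation $P$ a probability measure $\mu_P$ on $\Lambda$; for each measurement $M$ and outcome $k$ a measurable response function $\xi(k\mid\cdot,M):\Lambda\to[0,1]$ with $\sum_k\xi(k\mid\lambda,M)=1$ for all $\lambda$; such that $p(k\mid P,M)=\int_\Lambda\xi(k\mid\lambda,M)\,d\mu_P(\lambda)$. A mixture $P=\sum_\alpha w_\alpha P_\alpha$ is represented by $\mu_P=\sum_\alpha w_\alpha\mu_{P_\alpha}$. No outcome determinism or measurement noncontextuality is assumed. Preparations $P,P'$ are operationally equivalent if $p(k\mid P,M)=p(k\mid P',M)$ for all measurements $M$ of the theory and all outcomes $k$. The model is preparation noncontextual if operationally equivalent preparations have $\mu_P=\mu_{P'}$.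 $[n]=\{1,\dots,n\}$; $x_S=\bigoplus_{i\in S}x_i$; a perfect matching of $[n]$ is a set of $n/2$ disjoint pairs covering $[n]$; $\mathcal F_n=\{S\subseteq[n]:|S|\ne0,2\}$. A protocol for $\mathrm{HM}_n$ in an operational theory consists of a preparation $P_x$ for each $x\in\{0,1\}^n$ (Alice) and, for each perfect matching $\mathtt M$, a measurement (also denoted $\mathtt M$) whose outcomes are pairs $(\{i,j\},b)$ with $\{i,j\}\in\mathtt M$ and $b\in\{0,1\}$ (Bob). The output is correct if $b=x_i\oplus x_j$. For $S\subseteq[n]$ and $b\in\{0,1\}$ let $P_{S,b}$ be the mixture that samples $x$ uniformly from $\{x:x_S=b\}$ and implements $P_x$. The protocol is parity-oblivious if $p(k\mid P_{S,0},M)=p(k\mid P_{S,1},M)$ for all measurements $M$ of the theory, all outcomes $k$, and all $S\in\mathcal F_n$. $\mathrm{PoHM}_n$ is $\mathrm{HM}_n$ subject to parity-obliviousness. *)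

(* Defs.v *)
From HB Require Import structures.
From mathcomp Require Import all_boot all_order all_algebra.
From mathcomp Require Import all_classical all_reals all_analysis.

Set Implicit Arguments.
Unset Strict Implicit.
Unset Printing Implicit Defensive.

Import Order.TTheory GRing.Theory Num.Theory.

Local Open Scope ring_scope.

Record fdist (R : realType) (I : finType) := FDist {
  weight :> I -> R;
  weight_ge0 : forall i, 0 <= weight i;
  weight_sum1 : \sum_i weight i = 1 }.

Definition unif_weight (R : realType) (I : finType) (A : {set I}) (i : I) : R :=
  if i \in A then #|A|%:R^-1 else 0.

Lemma unif_weight_ge0 (R : realType) (I : finType) (A : {set I}) (i : I) :
  0 <= unif_weight R A i.
Proof. by rewrite /unif_weight; case: ifP => // _; rewrite invr_ge0. Qed.

Lemma unif_weight_sum1 (R : realType) (I : finType) (A : {set I}) :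
  A != finset.set0 -> \sum_i unif_weight R A i = 1.
Proof.
rewrite -card_gt0 => A0; rewrite /unif_weight -big_mkcond /= sumr_const.
by rewrite -[LHS]mulr_natr mulVf // pnatr_eq0 -lt0n.
Qed.

Definition unif (R : realType) (I : finType) (A : {set I}) (A0 : A != finset.set0) :
    fdist R I :=
  FDist (unif_weight_ge0 R A) (unif_weight_sum1 R A0).

(* Outcome sets are discrete but of arbitrary cardinality, hence the
   unordered sum [esum]. [mix] is proof-carrying through [fdist], so it never
   has to return a preparation for weights that are not a distribution. *)
Record op_theory (R : realType) := OpTheory {
  prep : Type;
  meas : Type;
  outcome : meas -> choiceType;
  prob : prep -> forall M : meas, outcome M -> R;
  prob_ge0 : forall P M (k : outcome M), 0 <= prob P k;
  prob_sum1 : forall P (M : meas),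
    \esum_(k in [set: outcome M]%classic) (prob P k)%:E = 1%E;
  mix : forall I : finType, fdist R I -> (I -> prep) -> prep;
  prob_mix : forall (I : finType) (w : fdist R I) (Ps : I -> prep) (M : meas)
      (k : outcome M),
    prob (mix w Ps) k = \sum_i w i * prob (Ps i) k }.

Definition op_equiv (R : realType) (T : op_theory R) (P P' : prep T) : Prop :=
  forall (M : meas T) (k : outcome M), prob P k = prob P' k.

(* Measures are functions on all subsets in the library; only their values on
   measurable sets are meaningful, so they are compared there. *)
Record ont_model (R : realType) (T : op_theory R) := OntModel {
  ont_disp : measure_display;
  ont_space : measurableType ont_disp;
  mu : prep T -> probability ont_space R;
  xi : forall M : meas T, outcome M -> ont_space -> R;
  xi_measurable : forall (M : meas T) (k : outcome M),
    measurable_fun [set: ont_space]%classic (xi k);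
  xi_ge0 : forall (M : meas T) (k : outcome M) l, 0 <= xi k l;
  xi_le1 : forall (M : meas T) (k : outcome M) l, xi k l <= 1;
  xi_sum1 : forall (M : meas T) l,
    \esum_(k in [set: outcome M]%classic) (xi k l)%:E = 1%E;
  prob_xi : forall P (M : meas T) (k : outcome M),
    (prob P k)%:E =
      (\int[mu P]_(l in [set: ont_space]%classic) (xi k l)%:E)%E;
  mu_mix : forall (I : finType) (w : fdist R I) (Ps : I -> prep T)
      (A : set ont_space), measurable A ->
    mu (mix w Ps) A = (\sum_i (w i)%:E * mu (Ps i) A)%E }.

Definition prep_noncontextual (R : realType) (T : op_theory R)
    (m : ont_model T) : Prop :=
  forall P P' : prep T, op_equiv P P' ->
  forall A : set (ont_space m), measurable A -> mu m P A = mu m P' A.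

Definition bits (n : nat) := {ffun 'I_n -> bool}.

Definition parity (n : nat) (x : bits n) (S : {set 'I_n}) : bool :=
  \big[addb/false]_(i in S) x i.

Definition calF (n : nat) : {set {set 'I_n}} :=
  [set S : {set 'I_n} | (#|S| != 0%N) && (#|S| != 2%N)].

Definition parity_class (n : nat) (S : {set 'I_n}) (b : bool) : {set bits n} :=
  [set x | parity x S == b].

Lemma parity_class_neq0 (n : nat) (S : {set 'I_n}) (b : bool) :
  S \in calF n -> parity_class S b != finset.set0.
Proof.
rewrite inE cards_eq0 => /andP[/finset.set0Pn[i iS] _].
apply/finset.set0Pn; exists [ffun j => b && (j == i)]; rewrite inE /parity.
rewrite (bigD1 i) //= big1 => [|j /andP[_ /negPf ji]].
  by rewrite ffunE eqxx andbT addbF.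
by rewrite ffunE ji andbF.
Qed.

Definition perfect_matching (n : nat) (M : {set {set 'I_n}}) : bool :=
  [&& #|M| == n./2, [forall e in M, #|e| == 2%N], finset.trivIset M
    & finset.cover M == [set: 'I_n]].

Definition pmatching (n : nat) :=
  {M : {set {set 'I_n}} | perfect_matching M}.

(* The pairs ({i,j}, b) with {i,j} in the matching. *)
Definition hm_output (n : nat) (M : pmatching n) :=
  ({e : {set 'I_n} | e \in val M} * bool)%type.

(* [out M] identifies the outcome set of the measurement for [M] with the set
   of pairs ({i,j}, b), {i,j} in M. *)
Record hm_protocol (R : realType) (T : op_theory R) (n : nat) := HMProtocol {
  alice : bits n -> prep T;
  bob : pmatching n -> meas T;
  out : forall M : pmatching n, hm_output M -> outcome (bob M);
  out_bij : forall M : pmatching n, bijective (@out M) }.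

Definition prep_parity (R : realType) (T : op_theory R) (n : nat)
    (pr : hm_protocol T n) (S : {set 'I_n}) (SF : S \in calF n) (b : bool) :
    prep T :=
  mix (unif R (parity_class_neq0 b SF)) (alice pr).

Definition parity_oblivious (R : realType) (T : op_theory R) (n : nat)
    (pr : hm_protocol T n) : Prop :=
  forall (S : {set 'I_n}) (SF : S \in calF n),
    op_equiv (prep_parity pr SF false) (prep_parity pr SF true).

Definition wins_hm (R : realType) (T : op_theory R) (n : nat)
    (pr : hm_protocol T n) : Prop :=
  forall (x : bits n) (M : pmatching n) (o : hm_output M) (i j : 'I_n),
    val o.1 = [set i; j] -> o.2 != x i (+) x j ->
    prob (alice pr x) (out pr o) = 0.

(* Main.v *)
(** For a measurable set [A], put [g x := mu_x A].  Noncontextuality turns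
    parity-obliviousness into the vanishing of every Fourier coefficient of [g]
    outside degrees 0 and 2.  At each ontic state every matching has an outcome
    of positive response, so finitely many sets [A] cover the ontic space, one
    for each choice of an outcome per matching, and for such an [A] perfect
    winning fixes [x_i (+) x_j] on the support of [g] for the chosen edge [{i,j}]
    of each matching.  "The parity [x_i (+) x_j] is constant on the support" is
    an equivalence relation on [[n]]; since it meets every perfect matching, it
    has a class of more than [n/2 >= 3] indices, and a function of degree at
    most 2 supported on points with four rigidly linked coordinates vanishes.
    Hence all the [A] are null, which is absurd. *)
Require Import Defs.
From mathcomp Require Import all_boot all_order all_algebra.
From mathcomp Require Import all_classical all_reals all_analysis.
From mathcomp Require Import measurable_realfun zify.

Set Implicit Arguments.
Unset Strict Implicit.
Unset Printing Implicit Defensive.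

Import Order.TTheory GRing.Theory Num.Theory.

Local Open Scope ring_scope.

(** * Perfect matchings that separate the fibres of a function *)

Section Matching.
Variables (n : nat) (f : 'I_n -> nat).
Hypotheses (n_even : ~~ odd n)
  (small : forall c, (#|[set i | f i == c]%SET| <= n./2)%N).

Let le_f : rel 'I_n := fun i j => (f i <= f j)%N.
Let s := sort le_f (enum 'I_n).

Let s_uniq : uniq s. Proof. by rewrite sort_uniq enum_uniq. Qed.
Let mem_s i : i \in s. Proof. by rewrite mem_sort mem_enum. Qed.
Let size_s : size s = n. Proof. by rewrite size_sort size_enum_ord. Qed.
Let s_sorted : sorted le_f s.
Proof. by apply: sort_sorted => i j; exact: leq_total. Qed.
Let n_half : n = (n./2 + n./2)%N.
Proof. by rewrite addnn even_halfK. Qed.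

Let pos i := index i s.
Let pos_lt i : (pos i < n)%N. Proof. by rewrite -size_s index_mem. Qed.
Let half_gt0 (i : 'I_n) : (0 < n./2)%N.
Proof. by have := pos_lt i; have := n_half; lia. Qed.
Let pos_inj : injective pos.
Proof. by move=> i j; apply: index_inj. Qed.
Let posK i : nth i s (pos i) = i. Proof. exact: nth_index. Qed.
Let pos_onto k : (k < n)%N -> exists i, pos i = k.
Proof.
move=> kn; pose i0 : 'I_n := Ordinal kn.
by exists (nth i0 s k); rewrite /pos index_uniq ?size_s.
Qed.
Let pos_mono i j : (pos i <= pos j)%N -> (f i <= f j)%N.
Proof.
move=> ij; rewrite -[X in f X](posK i) -[X in (_ <= f X)%N](posK j).
rewrite (set_nth_default j) ?size_s //.
apply: (sorted_leq_nth _ _ j s_sorted) => //.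
- by move=> ? ? ?; exact: leq_trans.
- by move=> ?; exact: leqnn.
- by rewrite inE size_s.
- by rewrite inE size_s.
Qed.

(** If [f i = f j], sortedness makes [f] constant on all positions from [pos i] to [pos j]; these
    are at least n/2 + 1 indices, too many for [small]. *)
Let far i j : (pos i + n./2 <= pos j)%N -> f i != f j.
Proof.
move=> ij; apply/eqP => fij.
have := small (f i); apply/negP; rewrite -ltnNge.
pose A := [set k : 'I_n | (pos i <= pos k <= pos j)%N]%SET.
have sub : A \subset [set k | f k == f i]%SET.
  apply/fintype.subsetP => k; rewrite !inE => /andP[/pos_mono ik /pos_mono kj].
  by rewrite eqn_leq ik fij kj.
apply: leq_trans (subset_leq_card sub).
pose h (t : 'I_(n./2).+1) : 'I_n := nth i s (pos i + t).
have ht (t : 'I_(n./2).+1) : pos (h t) = (pos i + t)%N.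
  rewrite /pos index_uniq ?size_s //.
  by have := pos_lt j; have := ltn_ord t; lia.
have h_inj : injective h.
  by move=> t u /(congr1 pos); rewrite !ht => /addnI/val_inj.
rewrite -[X in (X <= _)%N](card_ord (n./2).+1) -(card_imset _ h_inj).
apply/subset_leq_card/fintype.subsetP => k /imsetP[t _ ->].
by rewrite inE ht; have := ltn_ord t; lia.
Qed.

(* List the indices by increasing [f] and match positions [k] and [k + n/2]. *)
Lemma separating_matching : exists M : pmatching n,
  forall i j, i != j -> [set i; j]%SET \in val M -> f i != f j.
Proof.
pose q i := (pos i %% n./2)%N.
pose P := preim_partition q [set: 'I_n].
have PP : finset.partition P [set: 'I_n] := preim_partitionP q _.
have [/eqP Pcov Ptriv P0] := and3P PP.
have blockq B i j : B \in P -> i \in B -> (j \in B) = (q i == q j).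
  move=> BP iB; rewrite -(def_pblock Ptriv BP iB).
  by rewrite pblock_equivalence_partition ?inE //; split=> // /eqP ->.
have qP i j : i != j -> q i = q j ->
    (pos j = pos i + n./2)%N \/ (pos i = pos j + n./2)%N.
  move=> ij; rewrite /q => qij.
  have pij : pos i <> pos j by move/pos_inj/eqP; rewrite (negPf ij).
  have h0 := half_gt0 i.
  (* Positions are below n, so their quotients by n/2 are 0 or 1; equal remainders then put distinct
     positions exactly n/2 apart. *)
  have quot k : (pos k %/ n./2 < 2)%N.
    by rewrite ltn_divLR // mul2n -addnn -n_half.
  move: (quot i) (quot j) (divn_eq (pos i) n./2) (divn_eq (pos j) n./2) pij.
  rewrite qij; move: (pos j %% _)%N => r.
  case: (pos i %/ _)%N => [|[|//]]; case: (pos j %/ _)%N => [|[|//]] _ _;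
    by lia.
have card2 B : B \in P -> #|B| = 2%N.
  move=> BP; have /finset.set0Pn[i iB] : B != finset.set0.
    by apply: contraNneq P0 => <-.
  have [j [ij qij]] : exists j, i != j /\ q i = q j.
    have h0 := half_gt0 i.
    have [lt|ge] := ltnP (pos i) n./2.
    - have [j pj] : exists j, pos j = (pos i + n./2)%N.
        by apply: pos_onto; have := n_half; lia.
      exists j; split; first by apply/eqP => e; subst j; lia.
      by rewrite /q pj modnDr.
    - have [j pj] : exists j, pos j = (pos i - n./2)%N.
        by apply: pos_onto; have := pos_lt i; lia.
      exists j; split; first by apply/eqP => e; subst j; lia.
      by rewrite /q pj -[in LHS](subnK ge) modnDr.
  suff -> : B = [set i; j]%SET by rewrite cards2 ij.
  apply/setP => k; rewrite (blockq _ _ _ BP iB) !inE.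
  apply/eqP/orP => [qk|[/eqP->|/eqP->]] //.
  have [->|ki] := eqVneq k i; [by left | right].
  (* Both [k] and [j] lie n/2 away from [i], and with all positions below n there is only one such
     place. *)
  apply/eqP/pos_inj; rewrite eq_sym in ki.
  have := qP _ _ ij qij; have := qP _ _ ki qk.
  by have := pos_lt i; have := pos_lt j; have := pos_lt k; have := n_half; lia.
have Pperf : perfect_matching P.
  apply/and4P; split => //; last by rewrite Pcov.
  - have := card_uniform_partition (n := 2) card2 PP.
    rewrite cardsT card_ord muln2 => /(congr1 half); rewrite doubleK.
    by move=> /esym/eqP.
  - by apply/forall_inP => B /card2 ->.
exists (exist _ P Pperf) => i j ij /= eP.
have /esym/eqP qij := blockq _ i j eP (set21 i j); rewrite set22 in qij.
have [e|e] := qP _ _ ij qij; last rewrite eq_sym.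
- by apply: far; rewrite e.
- by apply: far; rewrite e.
Qed.

End Matching.

(** * Fourier analysis on the Boolean cube *)

Section Fourier.
Variables (R : realType) (n : nat).
Implicit Types (g : bits n -> R) (x : bits n) (S : {set 'I_n}).

Lemma sign_parity x S :
  (-1) ^+ parity x S = \prod_(i in S) (-1) ^+ x i :> R.
Proof. exact: (big_morph (fun b : bool => (-1) ^+ b) (@signr_addb R) erefl). Qed.

(** Pairing [g] with a test function spanned by characters of supersets of [D] gives 0, yet rigidity
    leaves [x0] as the only point that can contribute. *)
Lemma fourier_support_eq0 g x0 d (D : {set 'I_n}) :
  d \notin D ->
  (forall S, D \subset S -> \sum_x (-1) ^+ parity x S * g x = 0) ->
  (forall x i, g x != 0 -> i \in D -> (x i (+) x0 i) = (x d (+) x0 d)) ->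
  g x0 = 0.
Proof.
move=> dD ortho rigid.
pose u x i : R := (-1) ^+ x0 i * (-1) ^+ x i.
(* Up to a scalar, [phi] restricts [g] to the points that agree with [x0]
   off [D], with a sign; its characters are all indexed by supersets of [D]. *)
pose phi x : R := \prod_i (u x i + (i \notin D)%:R).
have u1 x i : x i = x0 i -> u x i = 1 by move=> e; rewrite /u e -signr_addb addbb.
have uN1 x i : x i != x0 i -> u x i = -1.
  by rewrite /u -signr_addb; case: (x i); case: (x0 i).
have phi_x0 : phi x0 != 0.
  by apply/prodf_neq0 => i _; rewrite u1.
have phig x : x != x0 -> phi x * g x = 0.
  move=> xx0; have [->|gx] := eqVneq (g x) 0; first by rewrite mulr0.
  (* A support point that agrees with [x0] at [d] agrees on all of [D], so it differs from [x0] off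
     [D]; in either case some factor of [phi] is -1 + 1. *)
  have [e|ne] := eqVneq (x d) (x0 d).
    have [i xi] : exists i, x i != x0 i.
      apply/existsP; apply: contraR xx0; rewrite negb_exists => /forallP h.
      by apply/eqP/ffunP => i; have := h i; rewrite negbK => /eqP.
    have iD : i \notin D.
      apply: contra xi => iD; have := rigid _ _ gx iD.
      by rewrite e addbb; case: (x i); case: (x0 i).
    by rewrite /phi (bigD1 i) //= uN1 // iD addNr !mul0r.
  by rewrite /phi (bigD1 d) //= uN1 // dD addNr !mul0r.
have : \sum_x phi x * g x = 0.
  under eq_bigr => x _.
    rewrite /phi bigA_distr mulr_suml.
    over.
  rewrite exchange_big /= big1 // => S _.
  have [DS|] := boolP (D \subset S); last first.
    case/subsetPn => i iD iS; rewrite big1 // => x _.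
    by rewrite (bigD1 i) //= (negPf iS) iD !mul0r.
  have E x : \prod_i (if i \in S then u x i else (i \notin D)%:R) =
      (-1) ^+ parity x0 S * (-1) ^+ parity x S.
    rewrite !sign_parity -big_split /= [RHS]big_mkcond /=.
    apply: eq_bigr => i _; case: ifPn => // iS.
    by rewrite (contra (fintype.subsetP DS i) iS).
  under eq_bigr => x _ do rewrite E -mulrA.
  by rewrite -mulr_sumr ortho ?mulr0.
rewrite (bigD1 x0) //= big1 ?addr0 => [|x]; last exact: phig.
by move/eqP; rewrite mulf_eq0 (negPf phi_x0) => /eqP.
Qed.

Lemma matched_support_eq0 g : (6 <= n)%N -> ~~ odd n ->
  (forall S, S \in calF n -> \sum_x (-1) ^+ parity x S * g x = 0) ->
  (forall M : pmatching n, exists i j b, [set i; j]%SET \in val M /\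
     forall x, b != x i (+) x j -> g x = 0) ->
  forall x, g x = 0.
Proof.
move=> n6 nev ortho hit x0; apply/eqP/negPn/negP => gx0.
(* [i] and [j] have a constant relative parity on the support of [g] exactly
   when [f i = f j]. *)
pose f i : nat := pickle [set x : bits n | (g x != 0) && (x i != x0 i)]%SET.
have rigid i j x : f i = f j -> g x != 0 -> x i (+) x0 i = x j (+) x0 j.
  move/(pcan_inj pickleK)/setP/(_ x); rewrite !inE => + gx.
  by rewrite gx /= !negb_eqb.
have [small|] := pselect (forall c, (#|[set i | f i == c]%SET| <= n./2)%N).
  have [M sep] := separating_matching nev small.
  have [i [j [b [eM eg]]]] := hit M.
  have card2 : #|[set i; j]%SET| = 2%N.
    by have /and4P[_ /forall_inP/(_ _ eM)/eqP] := valP M.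
  have ij : i != j by move: card2; rewrite cards2; case: eqP.
  (* On this edge the parity is [b] at every support point, [x0] included; hence [f i = f j],
     against [sep]. *)
  have /eqP[] := sep _ _ ij eM; congr pickle; apply/setP => x; rewrite !inE.
  have [//|gx] := eqVneq (g x) 0.
  have val_b y : g y != 0 -> b = y i (+) y j.
    by move=> gy; apply/eqP; apply: contraNT gy => /eg ->.
  have := val_b _ gx; rewrite (val_b _ gx0) /=.
  by case: (x i); case: (x j); case: (x0 i); case: (x0 j).
move/existsNP => [c /negP]; rewrite -ltnNge => large.
set C := [set i | f i == c]%SET in large.
have C4 : (4 <= #|C|)%N.
  by apply: leq_trans large; rewrite ltnS (half_leq n6).
have /card_gt0P[d dC] : (0 < #|C|)%N by apply: leq_trans C4.
apply/negP: gx0; apply/negPn/eqP.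
(* Removing [d] from [C] leaves at least three indices, so supersets of the rest avoid the sizes 0
   and 2. *)
apply: (@fourier_support_eq0 g x0 d (C :\ d)%SET); first by rewrite !inE eqxx.
- move=> S /subset_leq_card; rewrite (cardsD1 d) dC in C4 => CS.
  have S3 : (3 <= #|S|)%N by apply: leq_trans CS.
  by apply: ortho; rewrite inE; case: #|S| S3 => [|[|[]]].
- move=> x i gx; rewrite !inE => /andP[_ /eqP fi].
  by apply: rigid => //; rewrite fi; move: dC; rewrite inE => /eqP.
Qed.

(** Flipping one bit of [S] exchanges the two classes. *)
Lemma card_parity_class S : S \in calF n ->
  #|parity_class S false| = #|parity_class S true|.
Proof.
rewrite inE cards_eq0 => /andP[/finset.set0Pn[i iS] _].
pose flip x : bits n := [ffun j => x j (+) (j == i)].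
have flipK : involutive flip.
  by move=> x; apply/ffunP => j; rewrite !ffunE -addbA addbb addbF.
have par x : parity (flip x) S = ~~ parity x S.
  rewrite /parity (bigD1 i) //= [in RHS](bigD1 i) //= ffunE eqxx addbT addNb.
  congr (~~ (_ (+) _)); apply: eq_bigr => j /andP[_ /negPf ji].
  by rewrite ffunE ji addbF.
rewrite -(card_imset _ (inv_inj flipK)); congr #|pred_of_set _|.
apply/setP => x; rewrite -[x in LHS]flipK mem_imset ?inE ?par; last exact: inv_inj.
by case: parity.
Qed.

End Fourier.

(** * Responses and measures on the ontic space *)

Lemma positive_response (R : realType) (T : op_theory R) (m : ont_model T)
    (M : meas T) (l : ont_space m) : exists k : outcome M, 0 < xi k l.
Proof.
apply: contrapT => /forallNP h; have := xi_sum1 M l.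
rewrite esum1 => [/eqP|k _]; first by rewrite eq_sym onee_eq0.
by congr (_%:E); apply/eqP; rewrite eq_le xi_ge0 andbT leNgt; apply/negP.
Qed.

(** A nonnegative response with zero integral vanishes almost everywhere, while on [A] it is
    positive. *)
Lemma impossible_response_null (R : realType) (T : op_theory R)
    (m : ont_model T) (P : prep T) (M : meas T) (k : outcome M)
    (A : set (ont_space m)) : measurable A ->
  (forall l, A l -> 0 < xi k l) -> prob P k = 0 -> mu m P A = 0%E.
Proof.
move=> mA Apos pk0.
have mxi : measurable_fun [set: ont_space m] (fun l => (xi k l)%:E).
  exact/measurable_EFinP/xi_measurable.
have /(ae_eq_integral_abs (mu m P) measurableT mxi) [N [mN N0 sN]] :
    (\int[mu m P]_(l in [set: ont_space m]) `|(xi k l)%:E| = 0)%E.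
  rewrite -[RHS]/(0%:E) -pk0 (prob_xi m); apply: eq_integral => l _.
  by rewrite /= ger0_norm // xi_ge0.
apply: (subset_measure0 mA mN _ N0) => l Al; apply: sN => /= /(_ I) [] xi0.
by have := Apos l Al; rewrite xi0 ltxx.
Qed.

(** Noncontextuality gives both parity mixtures the same measure of [A]. Each is an average over its
    parity class, the classes have equal size, and the difference of the two sums is this Fourier
    coefficient. *)
Lemma oblivious_moment (R : realType) (n : nat) (T : op_theory R)
    (m : ont_model T) (pr : hm_protocol T n) (A : set (ont_space m))
    (S : {set 'I_n}) :
  prep_noncontextual m -> parity_oblivious pr -> measurable A ->
  S \in calF n ->
  \sum_x (-1) ^+ parity x S * fine (mu m (alice pr x) A) = 0.
Proof.
move=> nc po mA SF; set g := fun x => fine (mu m (alice pr x) A).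
have mix_mu b : mu m (prep_parity pr SF b) A =
    ((#|parity_class S b|%:R)^-1 * \sum_(x in parity_class S b) g x)%:E.
  rewrite mu_mix // mulr_sumr [in RHS]big_mkcond /= -sumEFin.
  apply: eq_bigr => x _; rewrite /= /unif_weight.
  rewrite -[mu m (alice pr x) A]fineK ?fin_num_measure //.
  by case: ifP => // _; rewrite mul0e.
have := nc _ _ (po S SF) A mA; rewrite !mix_mu card_parity_class // => -[].
have card0 : (#|parity_class S true|%:R)^-1 != 0 :> R.
  by rewrite invr_eq0 pnatr_eq0 cards_eq0 parity_class_neq0.
move=> /(mulfI card0) e.
rewrite (bigID (mem (parity_class S true))) /=.
rewrite (eq_bigr (fun x => - g x)) => [|x]; last first.
  by rewrite inE => /eqP ->; rewrite mulN1r.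
rewrite sumrN -e.
rewrite [X in _ + X](eq_big (mem (parity_class S false)) g) ?addNr // => x.
  by rewrite !inE; case: parity.
by rewrite inE; case: parity; rewrite // mul1r.
Qed.

Theorem theorem2 (R : realType) (n : nat) (n_ge6 : (6 <= n)%N)
    (n_even : ~~ odd n) :
  ~ exists (T : op_theory R) (m : ont_model T) (pr : hm_protocol T n),
      [/\ prep_noncontextual m, parity_oblivious pr & wins_hm pr].
Proof.
move=> [T [m [pr [nc po win]]]].
(* Finitely many matchings with finitely many outputs each make the cover by the sets [A o]
   finite. *)
pose selection := {dffun forall M : pmatching n, hm_output M}.
pose pos M (o : hm_output M) : set (ont_space m) :=
  [set l | 0 < xi (out pr o) l]%classic.
pose A (o : selection) := (\bigcap_(M in [set: pmatching n]) pos M (o M))%classic.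
have mpos M (o : hm_output M) : measurable (pos M o).
  rewrite /pos -preimage_itvoy -[X in measurable X]setTI.
  exact: xi_measurable (measurable_itv _).
have mA o : measurable (A o).
  by apply: fin_bigcap_measurable => [|M _]; [exact: finite_finset | exact: mpos].
have A0 o x : mu m (alice pr x) (A o) = 0%E.
  rewrite -[LHS]fineK ?fin_num_measure //; congr (_%:E).
  apply: (matched_support_eq0 (g := fun x => fine (mu m (alice pr x) (A o))))
    => // [S SF|M]; first exact: oblivious_moment.
  have /and4P[_ /forall_inP/(_ _ (valP (o M).1))/cards2P[i [j [ij e]]] _ _] :=
    valP M.
  exists i, j, (o M).2; split; first by rewrite -e; exact: valP.
  (* A string of the wrong parity never yields the output [o M], whose response is positive on
     [A o]. *)
  move=> y oij; rewrite (impossible_response_null (k := out pr (o M))) //.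
  - by move=> l /(_ M I).
  - exact: win e oij.
have cover : ([set: ont_space m] `<=` \bigcup_(o in [set: selection]) A o)%classic.
  move=> l _.
  have ex M : [exists o : hm_output M, 0 < xi (out pr o) l].
    have [k kl] := positive_response (bob pr M) l.
    have [inv _ invK] := out_bij pr M.
    by apply/existsP; exists (inv k); rewrite invK.
  exists [ffun M => xchoose (existsP (ex M))] => // M _.
  by rewrite /pos /= ffunE; exact: (xchooseP (existsP (ex M))).
(* Any preparation serves: a finite cover by null sets contradicts total mass 1. *)
pose x0 : bits n := [ffun=> false].
have : mu m (alice pr x0) [set: ont_space m]%classic = 0%E.
  apply/eqP; rewrite eq_le measure_ge0 andbT.
  have <- : (\sum_(o \in [set: selection]) mu m (alice pr x0) (A o) = 0)%E.
    by rewrite fsbig1.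
  by apply: content_sub_fsum => //; exact: finite_finset.
by rewrite probability_setT => /eqP; rewrite onee_eq0.
Qed.
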